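(* Let $k\ge 1$ and let $T=p\,q_1q_2\cdots q_k\,r$ (with $p\ge 2$, $r\ge 2$, and $q_i\ge 1$ for $i=1,\dots,k$) be a rational tangle in standard format with $k+2$ twist sites and $c=p+q_1+\cdots+q_k+r$ crossings. Let $N(T)$ be the standard diagram of the corresponding rational knot or link. Then $$\tilde\Lambda_{N(T)}(a,z)=\left\lceil\tfrac{k+2}{2}\right\rceil a^{2}z^{c-2}+(k+2)\,z^{c-2}+\left\lfloor\tfrac{k+2}{2}\right\rfloor a^{-2}z^{c-2}+a\,z^{c-1}+a^{-1}z^{c-1}.$$
   Context: Standard format. A rational tangle diagram in standard format is given by a finite sequence $(a_1,\dots,a_n)$ of positive integers, with $a_1\ge 2$ and $a_n\ge2$ (for $n=1$, $a_1\ge 2$), written $a_1a_2\cdots a_n$ (Conway notation). Its $i$-th twist site has $a_i$ crossings. Twist sites alternate between horizontal and vertical, and the last one is horizontal. The diagram is built in a herringbone pattern from the NW corner to the SE corner: the first twist site is a horizontal row of $a_1$ half twists of two strands if $n$ is odd, and a vertical column of $a_1$ half twists if $n$ is even. Each later vertical twist site is attached at the bottom (twisting the SW and SE endpoints), and each later horizontal one at the right (twisting the NE and SE endpoints). At every crossing, drawn as $\times$ with ends NW, NE, SW, SE, the overcrossing strand has positive slope (runs SW–NE). Thus the diagram is alternating, all horizontal twist sites are left-turning helices and all vertical ones are right-turning. For $n=k+2$ one writes $a_1=p$, $a_{i+1}=q_i$, $a_n=r$. The numerator closure $N(T)$ joins the NW endpoint to the NE endpoint and the SW endpoint to the SE endpoint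 by simple arcs outside the tangle. Kauffman's invariant. $\Lambda_D(a,z)\in\mathbb Z[a^{\pm1},z^{\pm1}]$ is Kauffman's two-variable regular isotopy invariant of unoriented link diagrams $D$ (invariant under Reidemeister moves II and III), determined by: (1) $\Lambda=1$ for a simple closed curve in the plane; (2) $\Lambda_{D_+}+\Lambda_{D_-}=z(\Lambda_{D_0}+\Lambda_{D_\infty})$, where the four diagrams agree outside a disk in which $D_+$ has a crossing with overstrand of positive slope, $D_-$ has the crossing with overstrand of negative slope, $D_0$ joins NW–SW and NE–SE, and $D_\infty$ joins NW–NE and SW–SE; (3) removing a curl consisting of a crossing whose NE and SE ends are joined by a small arc multiplies by a factor: $\Lambda(\text{with curl})=a\,\Lambda(\text{curl removed})$ if the overstrand has positive slope, and $\Lambda(\text{with curl})=a^{-1}\Lambda(\text{curl removed})$ if the overstrand has negative slope. Truncated invariant. For a reduced alternating diagram $D$ with $c$ crossings of a rational knot or link, $\tilde\Lambda_D(a,z)$ is the part of $\Lambda_D$ consisting of the terms in the monomials $a^{-2}z^{c-2}$, $z^{c-2}$, $a^{2}z^{c-2}$, $a^{-1}z^{c-1}$, $az^{c-1}$, i.e. $\tilde\Lambda_D=u_-a^{-2}z^{c-2}+u_0z^{c-2}+u_+a^2z^{c-2}+a^{-1}z^{c-1}+az^{c-1}$ (the coefficients of $a^{\pm1}z^{c-1}$ are known to be $1$). *)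

(* Defs.v *)
From HB Require Import structures.
From mathcomp Require Import all_boot all_order all_algebra.
From mathcomp Require Import finmap.
From mathcomp.multinomials Require Import monalg.

Set Implicit Arguments.
Unset Strict Implicit.
Unset Printing Implicit Defensive.

Import GRing.Theory.
Local Open Scope ring_scope.

(* The ring Z[a^{+-1}, z^{+-1}], as the group algebra of Z^2: the exponent    *)
(* (i, j) stands for a^i z^j. The product of monalg is not available here,    *)
(* since its exponents must form a monoid without nontrivial units.           *)

Definition laurent := {malg int[(int * int)%type]}.

HB.instance Definition _ := GRing.Zmodule.on laurent.

Definition mon (i j : int) : laurent := << (i, j) >>.

Definition laurent_mul (g h : laurent) : laurent :=
  \sum_(m <- msupp g) \sum_(n <- msupp h) << g@_m * h@_n *g m + n >>.

Section LaurentRing.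
Implicit Types (g h : laurent) (m n : int * int) (c : int).

Lemma laurent_mul_widen (d e : {fset (int * int)%type}) g h :
  (msupp g `<=` d)%fset -> (msupp h `<=` e)%fset ->
  laurent_mul g h =
    \sum_(m <- d) \sum_(n <- e) << g@_m * h@_n *g m + n >>.
Proof.
move=> le_d le_e; rewrite /laurent_mul (big_fset_incl _ le_d) /=.
  apply/eq_bigr => m _; apply/big_fset_incl => // n _ /mcoeff_outdom ->.
  by rewrite mulr0 monalgU0.
move=> m _ /mcoeff_outdom gm.
by rewrite big1 // => n _; rewrite gm mul0r monalgU0.
Qed.

Lemma laurent_mulC : commutative laurent_mul.
Proof.
move=> g h; rewrite /laurent_mul exchange_big.
by apply/eq_bigr => n _; apply/eq_bigr => m _; rewrite mulrC addrC.
Qed.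

Lemma laurent_mulDl : left_distributive laurent_mul +%R.
Proof.
move=> g1 g2 h; set d := (msupp g1 `|` msupp g2)%fset.
rewrite (@laurent_mul_widen d (msupp h) (g1 + g2)) ?msuppD_le //.
rewrite (@laurent_mul_widen d (msupp h) g1) ?fsubsetUl //.
rewrite (@laurent_mul_widen d (msupp h) g2) ?fsubsetUr //.
rewrite -big_split; apply/eq_bigr => m _.
rewrite -big_split; apply/eq_bigr => n _ /=.
by rewrite mcoeffD mulrDl monalgUD.
Qed.

Lemma laurent_mul0 : left_zero 0 laurent_mul.
Proof. by move=> g; rewrite /laurent_mul msupp0 big_seq_fset0. Qed.

Lemma laurent_mulUU c c' m n :
  laurent_mul << c *g m >> << c' *g n >> = << c * c' *g m + n >>.
Proof.
by rewrite (laurent_mul_widen msuppU_le msuppU_le) !big_seq_fset1 !mcoeffUU.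
Qed.

Lemma laurent_mul_suml (I : Type) (r : seq I) (F : I -> laurent) h :
  laurent_mul (\sum_(i <- r) F i) h = \sum_(i <- r) laurent_mul (F i) h.
Proof.
exact: (big_morph (laurent_mul^~ h) (fun x y => laurent_mulDl x y h)
          (laurent_mul0 h)).
Qed.

Lemma laurent_mul_sumr (I : Type) (r : seq I) (F : I -> laurent) h :
  laurent_mul h (\sum_(i <- r) F i) = \sum_(i <- r) laurent_mul h (F i).
Proof.
rewrite laurent_mulC laurent_mul_suml.
by apply/eq_bigr => i _; rewrite laurent_mulC.
Qed.

Lemma laurent_mulEl g h :
  laurent_mul g h = \sum_(m <- msupp g) laurent_mul << g@_m *g m >> h.
Proof. by rewrite -laurent_mul_suml -monalgE. Qed.

Lemma laurent_mulEr g h :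
  laurent_mul g h = \sum_(n <- msupp h) laurent_mul g << h@_n *g n >>.
Proof. by rewrite -laurent_mul_sumr -monalgE. Qed.

Lemma laurent_mulA : associative laurent_mul.
Proof.
move=> g1 g2 g3.
rewrite [LHS]laurent_mulEl (laurent_mulEl g1 g2) [RHS]laurent_mul_suml.
apply/eq_bigr => m1 _.
rewrite (laurent_mulEl g2 g3) (laurent_mulEr _ g2).
rewrite [LHS]laurent_mul_sumr [RHS]laurent_mul_suml; apply/eq_bigr => m2 _.
rewrite (laurent_mulEr _ g3) [LHS]laurent_mul_sumr [RHS]laurent_mulEr.
by apply/eq_bigr => m3 _; rewrite !laurent_mulUU mulrA addrA.
Qed.

Lemma laurent_mul1 : left_id (mon 0 0) laurent_mul.
Proof.
move=> g; rewrite [g in LHS]monalgE laurent_mul_sumr [RHS]monalgE.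
by apply/eq_bigr => m _; rewrite laurent_mulUU mul1r add0r.
Qed.

Lemma laurent1_neq0 : mon 0 0 != 0.
Proof. by apply/eqP/malgP => /(_ (0, 0)) /eqP; rewrite mcoeffUU mcoeff0. Qed.

End LaurentRing.

HB.instance Definition _ := GRing.Zmodule_isComNzRing.Build laurent
  laurent_mulA laurent_mulC laurent_mul1 laurent_mulDl laurent1_neq0.

(* Unoriented plane tangle and link diagrams in Morse position, read from     *)
(* bottom to top: a diagram is a sequence of horizontal slices. A slice       *)
(* (s, i) consists of vertical strands and one piece s whose leftmost strand  *)
(* has i strands to its left (strands are numbered from 0):                   *)
(*   Cup, a local minimum, creates the strands i and i+1;                     *)
(*   Cap, a local maximum, joins the strands i and i+1;                       *)
(*   Cross b crosses the strands i and i+1, and its overstrand has positive   *)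
(*     slope (SW-NE) if b is true, negative slope (SE-NW) if b is false.      *)

Inductive piece := Cup | Cap | Cross of bool.

Definition diagram := seq (piece * nat).

Definition ins (s : piece) : nat := if s is Cup then 0 else 2.
Definition outs (s : piece) : nat := if s is Cap then 0 else 2.

(* The number of strands at the top of w when there are n at the bottom, or   *)
(* None if some slice of w refers to a missing strand.                        *)
Fixpoint top_strands (n : nat) (w : diagram) : option nat :=
  if w is (s, i) :: w' then
    if (i + ins s <= n)%N then top_strands (n - ins s + outs s) w' else None
  else Some n.

Definition is_link_diagram (w : diagram) : bool := top_strands 0 w == Some 0%N.

Definition crossings (w : diagram) : nat :=
  count (fun x => if x.1 is Cross _ then true else false) w.

(* Generating local moves of regular isotopy. The first six constructors      *)
(* generate isotopy of the plane: exchange of heights of distant pieces,      *)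
(* cancellation of a minimum with an adjacent maximum, and rotation of a      *)
(* crossing near a maximum or a minimum (the slope of a crossing changes sign *)
(* under a quarter turn). The others are Reidemeister moves II and III.       *)
Inductive local_move : diagram -> diagram -> Prop :=
| Exchange s t i d :
    local_move [:: (s, i); (t, i + outs s + d)%N]
               [:: (t, i + ins s + d)%N; (s, i)]
| ZigZag i : local_move [:: (Cup, i.+1); (Cap, i)] [::]
| ZagZig i : local_move [:: (Cup, i); (Cap, i.+1)] [::]
| RotateCap b i :
    local_move [:: (Cross b, i.+1); (Cap, i)] [:: (Cross (~~ b), i); (Cap, i.+1)]
| RotateCup b i :
    local_move [:: (Cup, i); (Cross b, i.+1)] [:: (Cup, i.+1); (Cross (~~ b), i)]
| ReidemeisterII b i : local_move [:: (Cross b, i); (Cross (~~ b), i)] [::]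
| ReidemeisterIII b i :
    local_move [:: (Cross b, i); (Cross b, i.+1); (Cross b, i)]
               [:: (Cross b, i.+1); (Cross b, i); (Cross b, i.+1)].

(* The curl on the strand i made of a crossing of the strands i and i+1 whose *)
(* NE and SE ends are joined by an arc on the right.                          *)
Definition curl (b : bool) (i : nat) : diagram :=
  [:: (Cup, i.+1); (Cross b, i); (Cap, i.+1)].

(* Only the values of L on link diagrams matter. In the skein relation, the   *)
(* smoothing D_0 (NW-SW, NE-SE) is two vertical strands, and D_oo (NW-NE,     *)
(* SW-SE) is a cap below a cup.                                               *)
Record is_kauffman_invariant (L : diagram -> laurent) : Prop := {
  kauffman_isotopy : forall u v w w' : diagram, local_move w w' ->
    is_link_diagram (u ++ w ++ v) -> is_link_diagram (u ++ w' ++ v) ->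
    L (u ++ w ++ v) = L (u ++ w' ++ v);
  kauffman_circle : L [:: (Cup, 0%N); (Cap, 0%N)] = 1;
  kauffman_skein : forall (u v : diagram) (i : nat),
    is_link_diagram (u ++ [:: (Cross true, i)] ++ v) ->
    L (u ++ [:: (Cross true, i)] ++ v) + L (u ++ [:: (Cross false, i)] ++ v)
    = mon 0 1 * (L (u ++ v) + L (u ++ [:: (Cap, i); (Cup, i)] ++ v));
  kauffman_curl : forall (u v : diagram) (b : bool) (i : nat),
    is_link_diagram (u ++ curl b i ++ v) ->
    L (u ++ curl b i ++ v) = mon (if b then 1 else -1) 0 * L (u ++ v)
}.

(* Tangles with four ends: diagrams with two strands at the bottom (SW, SE)   *)
(* and two at the top (NW, NE).                                               *)

(* In hsum_crossing, the NE and SE ends of T are joined to the NW and SW ends *)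
(* of a new crossing on its right; in vsum_crossing, the SW and SE ends of T  *)
(* are joined to the NW and NE ends of a new crossing below it.               *)
Definition hsum_crossing (T : diagram) : diagram :=
  (Cup, 1%N) :: T ++ [:: (Cross true, 2%N); (Cap, 1%N)].

Definition vsum_crossing (T : diagram) : diagram := (Cross true, 0%N) :: T.

(* Attaches to T twist sites with the numbers of crossings listed in s,       *)
(* alternately on the right and at the bottom, first on the right iff h.      *)
Fixpoint add_twist_sites (h : bool) (T : diagram) (s : seq nat) : diagram :=
  if s is a :: s' then
    add_twist_sites (~~ h)
      (iter a (if h then hsum_crossing else vsum_crossing) T) s'
  else T.

(* The first twist site is horizontal iff the number of sites is odd, so that *)
(* the last one is horizontal. A horizontal row is obtained by adding         *)
(* crossings on the right of two horizontal arcs, and a vertical column by    *)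
(* adding crossings below two vertical arcs.                                  *)
Definition rational_tangle (s : seq nat) : diagram :=
  let h := odd (size s) in
  add_twist_sites h (if h then [:: (Cap, 0%N); (Cup, 0%N)] else [::]) s.

Definition numerator (T : diagram) : diagram :=
  (Cup, 0%N) :: T ++ [:: (Cap, 0%N)].

(* The part of L D in the monomials a^{-2} z^{c-2}, z^{c-2}, a^2 z^{c-2},     *)
(* a^{-1} z^{c-1}, a z^{c-1}, where c is the number of crossings of D.        *)
Definition truncated (L : diagram -> laurent) (D : diagram) : laurent :=
  let c : int := (crossings D)%:Z in
  \sum_(m <- [:: (-2, c - 2); (0, c - 2); (2, c - 2); (-1, c - 1); (1, c - 1)])
    << (L D)@_m *g m >>.

(* Main.v *)
Require Import Defs.
From mathcomp Require Import all_boot all_order all_algebra.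
From mathcomp Require Import ring zify.
From mathcomp.multinomials Require Import monalg.

Set Implicit Arguments.
Unset Strict Implicit.
Unset Printing Implicit Defensive.

Local Open Scope ring_scope.
Import GRing.Theory.

(** In the skein module of diagrams with four ends, every rational tangle is a
    combination of three diagrams: two vertical arcs, two horizontal arcs and a
    single crossing of positive slope. Write [x], [y], [w] for the coefficients,
    where [x] belongs to the pair of arcs on which a further crossing of the
    current twist site makes a curl, and [y] to the pair of arcs which that
    crossing turns into a single crossing. The skein relation shows that
    attaching the crossing has the effect

      x' = alpha (x + z w),    y' = - w,    w' = y + z w,

    where alpha is [a] for horizontal sites and [a^-1] for vertical ones
    ([expands_attach]). Passing to the next twist site exchanges [x] with [y]
    and [a] with [a^-1].

    Only the top of these polynomials in z matters. With [n + 2] crossings,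

      x = alpha z^(n+1) + ...,    y = - z^n + ...,
      w = z^(n+1) + omega z^n + ...,

    and the recursion preserves this shape ([leading_same], [leading_switch]).
    The coefficient omega is constant along a twist site; it increases by
    alpha each time a site of factor alpha is left for the next one, so that it
    only counts the changes of direction. Closing up, with the values [1],
    [z^-1 (a + a^-1) - 1] and [a^-1] of the three closed diagrams, gives

      (a + a^-1) z^(c-1) + (a^2 + (a + a^-1) omega + 1) z^(c-2) + ...

    ([numerator_leading]). For [k + 2] sites, the last of which is horizontal,
    omega is the number of odd-numbered changes of direction, counted from the
    last, times [a^-1], plus the number of even-numbered ones times [a]; this
    is the formula ([main_part_mon]). *)

(** * Laurent polynomials and their degree in z *)

Lemma monM i j i' j' : mon i j * mon i' j' = mon (i + i') (j + j').
Proof. exact: (laurent_mulUU 1 1 (i, j) (i', j')). Qed.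

Lemma mon_z_expr n : mon 0 1 ^+ n = mon 0 n%:Z.
Proof.
elim: n => [|n IHn]; first exact: expr0.
by rewrite exprS IHn monM.
Qed.

(** The coefficients remain Laurent polynomials in a throughout; this filtration
    ignores the exponent of a. *)
Definition zdeg_le (d : int) (f : laurent) : Prop :=
  forall i j, d < j -> f@_(i, j) = 0.

Lemma zdeg_leW d d' f : d <= d' -> zdeg_le d f -> zdeg_le d' f.
Proof. by move=> le_dd' f_le i j lt_d'j; apply: f_le; lia. Qed.

Lemma zdeg_leD d f g : zdeg_le d f -> zdeg_le d g -> zdeg_le d (f + g).
Proof. by move=> f_le g_le i j dj; rewrite mcoeffD f_le // g_le // addr0. Qed.

Lemma zdeg_leN d f : zdeg_le d f -> zdeg_le d (- f).
Proof. by move=> f_le i j dj; rewrite mcoeffN f_le // oppr0. Qed.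

Lemma zdeg_leM d d' e f g :
  zdeg_le d f -> zdeg_le d' g -> d + d' <= e -> zdeg_le e (f * g).
Proof.
move=> f_le g_le le_e i j lt_ej.
rewrite [f * g]/(laurent_mul f g) /laurent_mul raddf_sum big1 //= => -[m1 m2] _.
rewrite raddf_sum big1 //= => -[n1 n2] _; rewrite mcoeffU.
case: eqP => [[_ eq_j]|_]; last exact: mulr0n.
have [lt_dm|le_md] := boolP (d < m2); first by rewrite f_le ?mul0r ?mul0rn.
by rewrite g_le ?mulr0 ?mul0rn //; move: eq_j; rewrite /=; lia.
Qed.

Lemma zdeg_le_mon i j : zdeg_le j (mon i j).
Proof.
move=> p q lt_jq; rewrite mcoeffU xpair_eqE.
by rewrite (_ : (j == q) = false) ?andbF //; lia.
Qed.

Lemma zdeg_le_natMmon n i j : zdeg_le j (n%:R * mon i j).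
Proof.
elim: n => [|n IHn]; first by rewrite mul0r => p q _; rewrite mcoeff0.
by rewrite mulrS mulrDl mul1r; apply: zdeg_leD IHn; apply: zdeg_le_mon.
Qed.

Local Notation z := (mon 0 1).

(** Also the factor alpha of a twist site: a crossing of positive slope closed
    up on the left or on the right, as happens in a horizontal site, is a curl of
    factor [a]; closed up above or below, as in a vertical site, it has negative
    slope after a quarter turn. *)
Definition curl_factor (b : bool) : laurent := mon (if b then 1 else -1) 0.

Lemma z_inj : injective ( *%R z).
Proof.
apply: (can_inj (g := *%R (mon 0 (-1)))) => f.
by rewrite mulrA monM mul1r.
Qed.

(** * The recursion for the coefficients, and its leading terms *)

(** The coefficient omega of a tangle whose current direction is [h], reached
    after [j] changes of direction: the last change left a site of direction
    [~~ h], the one before a site of direction [h], and so on. *)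
Definition transitions (h : bool) (j : nat) : laurent :=
  (uphalf j)%:R * curl_factor (~~ h) + (j./2)%:R * curl_factor h.

Lemma transitionsS h j :
  transitions (~~ h) j.+1 = transitions h j + curl_factor h.
Proof. by rewrite /transitions /= negbK uphalfE /= -!natr1; ring. Qed.

Lemma zdeg_le_curl_factor h : zdeg_le 0 (curl_factor h).
Proof. exact: zdeg_le_mon. Qed.

Lemma zdeg_le_transitions h j : zdeg_le 0 (transitions h j).
Proof. by apply: zdeg_leD; apply: zdeg_le_natMmon. Qed.

Lemma zdeg_le_z n : zdeg_le n%:Z (z ^+ n).
Proof. by rewrite mon_z_expr; apply: zdeg_le_mon. Qed.

(** The shape of the coefficients of a tangle with [n + 2] crossings. The second
    coefficient of [x] is left open: it differs between a site of one crossing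
    and a longer one, and later it only affects the third coefficient of [w]. *)
Record leading (h : bool) (j n : nat) (x y w : laurent) : Prop := {
  leading_turn : zdeg_le n%:Z (x - curl_factor h * z ^+ n.+1);
  leading_flat : zdeg_le (n%:Z - 1) (y + z ^+ n);
  leading_cross : zdeg_le (n%:Z - 1) (w - z ^+ n.+1 - transitions h j * z ^+ n)
}.

Section Leading.
Variables (h : bool) (j n : nat) (x y w : laurent).
Hypothesis xyw : leading h j n x y w.

Lemma leading_turn_le : zdeg_le n.+1%:Z x.
Proof.
rewrite -[x](subrK (curl_factor h * z ^+ n.+1)); apply: zdeg_leD.
  by apply: zdeg_leW (leading_turn xyw); lia.
by apply: (zdeg_leM (@zdeg_le_curl_factor h) (@zdeg_le_z n.+1)); lia.
Qed.

Lemma leading_flat_le : zdeg_le n%:Z y.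
Proof.
rewrite -[y](addrK (z ^+ n)); apply: zdeg_leD; last exact/zdeg_leN/@zdeg_le_z.
by apply: zdeg_leW (leading_flat xyw); lia.
Qed.

Lemma leading_cross_le : zdeg_le n%:Z (w - z ^+ n.+1).
Proof.
rewrite -[_ - _](subrK (transitions h j * z ^+ n)); apply: zdeg_leD.
  by apply: zdeg_leW (leading_cross xyw); lia.
by apply: (zdeg_leM (@zdeg_le_transitions h j) (@zdeg_le_z n)); lia.
Qed.

Lemma leading_z_cross :
  zdeg_le n%:Z (z * (w - z ^+ n.+1 - transitions h j * z ^+ n)).
Proof. by apply: (zdeg_leM (@zdeg_le_z 1) (leading_cross xyw)); lia. Qed.

Lemma leading_same :
  leading h j n.+1 (curl_factor h * (x + z * w)) (- w) (y + z * w).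
Proof.
split.
- have -> : curl_factor h * (x + z * w) - curl_factor h * z ^+ n.+2
     = curl_factor h * (x + z * (w - z ^+ n.+1)) by rewrite !exprS; ring.
  apply: (@zdeg_leM 0 n.+1); [exact: @zdeg_le_curl_factor | | by lia].
  apply: zdeg_leD leading_turn_le _.
  by apply: (zdeg_leM (@zdeg_le_z 1) leading_cross_le); lia.
- rewrite (_ : - w + _ = - (w - z ^+ n.+1)); last by ring.
  by apply: zdeg_leN; apply: zdeg_leW leading_cross_le; lia.
- have -> : y + z * w - z ^+ n.+2 - transitions h j * z ^+ n.+1
     = y + z * (w - z ^+ n.+1 - transitions h j * z ^+ n) by rewrite !exprS; ring.
  apply: (@zdeg_leW n); first by lia.
  exact: zdeg_leD leading_flat_le leading_z_cross.
Qed.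

(** The old [x], of leading term [curl_factor h * z ^+ n.+1], takes the place of
    [y] in the recursion for [w]; this is the increment of omega. *)
Lemma leading_switch :
  leading (~~ h) j.+1 n.+1 (curl_factor (~~ h) * (y + z * w)) (- w) (x + z * w).
Proof.
split.
- have -> : curl_factor (~~ h) * (y + z * w) - curl_factor (~~ h) * z ^+ n.+2
     = curl_factor (~~ h) * (y + z * (w - z ^+ n.+1)) by rewrite !exprS; ring.
  apply: (@zdeg_leM 0 n.+1); [exact: @zdeg_le_curl_factor | | by lia].
  apply: zdeg_leD; first by apply: zdeg_leW leading_flat_le; lia.
  by apply: (zdeg_leM (@zdeg_le_z 1) leading_cross_le); lia.
- rewrite (_ : - w + _ = - (w - z ^+ n.+1)); last by ring.
  by apply: zdeg_leN; apply: zdeg_leW leading_cross_le; lia.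
- have -> : x + z * w - z ^+ n.+2 - transitions (~~ h) j.+1 * z ^+ n.+1
     = (x - curl_factor h * z ^+ n.+1)
       + z * (w - z ^+ n.+1 - transitions h j * z ^+ n).
    by rewrite transitionsS !exprS; ring.
  apply: (@zdeg_leW n); first by lia.
  exact: zdeg_leD (leading_turn xyw) leading_z_cross.
Qed.

End Leading.

(** * Diagrams in a context *)

Lemma top_strands_cat n w w' :
  top_strands n (w ++ w') = obind (top_strands^~ w') (top_strands n w).
Proof. by elim: w n => //= -[s i] w IHw n; case: ifP. Qed.

(** Slices refer to strands counted from the left, so additional strands on the
    right are harmless. *)
Lemma top_strands_widen m n n' w :
  top_strands n w = Some n' -> top_strands (n + m) w = Some (n' + m)%N.
Proof.
elim: w n => [|[s i] w IHw] n /=; first by case=> ->.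
case: ifP => // le_in /IHw; rewrite (_ : (i + ins s <= n + m)%N = true); last lia.
by rewrite (_ : (n + m - ins s + outs s = n - ins s + outs s + m)%N); last lia.
Qed.

(** What may be put between [u] and [v] to make a link diagram: pieces using the
    [n] leftmost strands at the bottom and the [n'] leftmost at the top, next to
    [m] strands that they do not touch. *)
Definition context (n n' : nat) (u v : diagram) : Prop :=
  exists2 m, top_strands 0 u = Some (n + m)%N &
             top_strands (n' + m) v = Some 0%N.

Lemma context_link n n' u v w : context n n' u v ->
  top_strands n w = Some n' -> is_link_diagram (u ++ w ++ v).
Proof.
case=> m u_top v_top w_top; rewrite /is_link_diagram !top_strands_cat u_top /=.
by rewrite top_strands_cat (top_strands_widen m w_top) /= v_top.
Qed.

Lemma context_extend n n' n1 n1' u v w w' : context n n' u v ->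
  top_strands n w = Some n1 -> top_strands n1' w' = Some n' ->
  context n1 n1' (u ++ w) (w' ++ v).
Proof.
case=> m u_top v_top w_top w'_top; exists m; rewrite top_strands_cat.
  by rewrite u_top /= (top_strands_widen m w_top).
by rewrite (top_strands_widen m w'_top).
Qed.

Lemma context_shift k n n' u v :
  context (n + k) (n' + k) u v -> context n n' u v.
Proof. by case=> m u_top v_top; exists (k + m)%N; rewrite addnA. Qed.

Section Skein.
Variable Lambda : diagram -> laurent.
Hypothesis hLambda : is_kauffman_invariant Lambda.

Section InContext.
Variables (n n' : nat) (u v : diagram).
Hypothesis uv : context n n' u v.
Let E w := Lambda (u ++ w ++ v).

Lemma isotopy_in l r w w' : local_move w w' ->
  top_strands n (l ++ w ++ r) = Some n' ->
  top_strands n (l ++ w' ++ r) = Some n' ->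
  E (l ++ w ++ r) = E (l ++ w' ++ r).
Proof.
move=> ww' /(context_link uv) D /(context_link uv) D'.
move: (kauffman_isotopy hLambda (u := u ++ l) (v := r ++ v) ww').
by rewrite /E !catA in D D' *; apply.
Qed.

Lemma skein_in l r i :
  top_strands n (l ++ [:: (Cross true, i)] ++ r) = Some n' ->
  E (l ++ [:: (Cross true, i)] ++ r) + E (l ++ [:: (Cross false, i)] ++ r)
  = z * (E (l ++ r) + E (l ++ [:: (Cap, i); (Cup, i)] ++ r)).
Proof.
move=> /(context_link uv) D.
move: (kauffman_skein hLambda (u := u ++ l) (v := r ++ v) (i := i)).
by rewrite /E !catA in D *; apply.
Qed.

Lemma curl_in l r b i :
  top_strands n (l ++ curl b i ++ r) = Some n' ->
  E (l ++ curl b i ++ r) = curl_factor b * E (l ++ r).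
Proof.
move=> /(context_link uv) D.
move: (kauffman_curl hLambda (u := u ++ l) (v := r ++ v) (b := b) (i := i)).
by rewrite /E !catA in D *; apply.
Qed.

End InContext.

Local Notation X b i := (Cross b, i%N).

(* One step of an isotopy, applied to the left-hand side of the goal: the move  *)
(* [m], or its inverse, between the slices [l] below and [r] above. The slices  *)
(* are given explicitly because the goal determines them up to conversion only. *)
Ltac iso uv l m r :=
  apply: (eq_trans (isotopy_in uv (l := l) (r := r) m erefl erefl)).
Ltac isoV uv l m r :=
  apply: (eq_trans (esym (isotopy_in uv (l := l) (r := r) m erefl erefl))).

(** * Skein computations for four ends *)

(** A crossing below a maximum is a curl: create a zigzag on the right-hand
    strand and turn the crossing around its minimum, which reverses the slope. *)
Lemma cross_cap u v b : context 2 0 u v ->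
  Lambda (u ++ [:: X b 0; (Cap, 0%N)] ++ v)
  = curl_factor (~~ b) * Lambda (u ++ [:: (Cap, 0%N)] ++ v).
Proof.
move=> uv.
rewrite -(curl_in uv (l := [::]) (r := [:: (Cap, 0%N)]) (b := ~~ b) (i := 1) erefl).
symmetry.
isoV uv ([::] : diagram) (RotateCup b 1) [:: (Cap, 2%N); (Cap, 0%N)].
isoV uv [:: (Cup, 1%N); X b 2] (Exchange Cap Cap 0 0) ([::] : diagram).
isoV uv [:: (Cup, 1%N)] (Exchange Cap (Cross b) 0 0) [:: (Cap, 0%N)].
iso uv ([::] : diagram) (ZigZag 0) [:: X b 0; (Cap, 0%N)].
by [].
Qed.

Lemma cross_cross u v : context 2 2 u v ->
  Lambda (u ++ [:: X true 0; X true 0] ++ v)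
  = z * (Lambda (u ++ [:: X true 0] ++ v)
         + curl_factor false * Lambda (u ++ [:: (Cap, 0%N); (Cup, 0%N)] ++ v))
    - Lambda (u ++ v).
Proof.
move=> uv.
have uv_cap : context 2 0 u ([:: (Cup, 0%N)] ++ v).
  by rewrite -[u]cats0; apply: context_extend uv _ _.
have /= <- := cross_cap true uv_cap.
have <- : Lambda (u ++ [:: X true 0; X false 0] ++ v) = Lambda (u ++ v).
  by iso uv ([::] : diagram) (ReidemeisterII true 0) ([::] : diagram).
have /= <- := skein_in uv (l := [:: X true 0]) (r := [::]) (i := 0) erefl.
by rewrite addrK.
Qed.

(** Two horizontal arcs are neutral for the horizontal sum. *)
Lemma hsum_arcs u v b : context 2 2 u v ->
  Lambda (u ++ [:: (Cup, 1%N); (Cap, 0%N); (Cup, 0%N); X b 2; (Cap, 1%N)] ++ v)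
  = Lambda (u ++ [:: X b 0] ++ v).
Proof.
move=> uv.
iso uv ([::] : diagram) (ZigZag 0) [:: (Cup, 0%N); X b 2; (Cap, 1%N)].
iso uv ([::] : diagram) (Exchange Cup (Cross b) 0 0) [:: (Cap, 1%N)].
iso uv [:: X b 0] (ZagZig 0) ([::] : diagram).
by [].
Qed.

(** A Reidemeister move II seen sideways: a quarter turn of both crossings stacks
    them vertically. *)
Lemma hsum_inverse u v b : context 2 2 u v ->
  Lambda (u ++ [:: (Cup, 1%N); X b 0; X (~~ b) 2; (Cap, 1%N)] ++ v)
  = Lambda (u ++ [:: (Cap, 0%N); (Cup, 0%N)] ++ v).
Proof.
move=> uv.
iso uv [:: (Cup, 1%N); X b 0] (RotateCap (~~ b) 1) ([::] : diagram).
rewrite -[b in X b 0]negbK.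
isoV uv ([::] : diagram) (RotateCup (~~ b) 0) [:: X (~~ ~~ b) 1; (Cap, 2%N)].
iso uv [:: (Cup, 0%N)] (ReidemeisterII (~~ b) 1) [:: (Cap, 2%N)].
iso uv ([::] : diagram) (Exchange Cup Cap 0 0) ([::] : diagram).
by [].
Qed.

Lemma hsum_cross_skein_right u v : context 2 2 u v ->
  Lambda (u ++ [:: (Cup, 1%N); X true 0; X true 2; (Cap, 1%N)] ++ v)
  = z * (curl_factor true * Lambda (u ++ v) + Lambda (u ++ [:: X true 0] ++ v))
    - Lambda (u ++ [:: (Cap, 0%N); (Cup, 0%N)] ++ v).
Proof.
move=> uv; rewrite -(hsum_inverse true uv).
have -> : Lambda (u ++ [:: X true 0] ++ v)
  = Lambda (u ++ [:: (Cup, 1%N); X true 0; (Cap, 2%N); (Cup, 2%N); (Cap, 1%N)] ++ v).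
  symmetry.
  iso uv [:: (Cup, 1%N); X true 0; (Cap, 2%N)] (ZigZag 1) ([::] : diagram).
  iso uv [:: (Cup, 1%N)] (Exchange (Cross true) Cap 0 0) ([::] : diagram).
  by iso uv ([::] : diagram) (ZagZig 1) [:: X true 0].
have /= <- := curl_in uv (l := [::]) (r := [::]) (b := true) (i := 0) erefl.
have /= <- := skein_in uv (l := [:: (Cup, 1%N); X true 0]) (r := [:: (Cap, 1%N)])
                (i := 2) erefl.
by rewrite addrK.
Qed.

Lemma hsum_cross_skein_left u v : context 2 2 u v ->
  Lambda (u ++ [:: (Cup, 1%N); X true 0; X true 2; (Cap, 1%N)] ++ v)
  = z * (Lambda (u ++ [:: (Cup, 1%N); X true 2; (Cap, 1%N)] ++ v)
         + Lambda (u ++ [:: X true 0] ++ v))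
    - Lambda (u ++ [:: (Cap, 0%N); (Cup, 0%N)] ++ v).
Proof.
move=> uv; rewrite -(hsum_inverse false uv) -(hsum_arcs true uv).
have /= <- := skein_in uv (l := [:: (Cup, 1%N)]) (r := [:: X true 2; (Cap, 1%N)])
                (i := 0) erefl.
by rewrite addrK.
Qed.

(** The curl relation is about arcs on the right of a crossing. Instead of
    sliding a curl to the other side, resolve either one of the two crossings in
    a row: the two expansions agree except that one contains a right curl where
    the other has a left curl, and z is invertible. *)
Lemma left_curl u v : context 2 2 u v ->
  Lambda (u ++ [:: (Cup, 1%N); X true 2; (Cap, 1%N)] ++ v)
  = curl_factor true * Lambda (u ++ v).
Proof.
move=> uv.
have := hsum_cross_skein_left uv; rewrite (hsum_cross_skein_right uv).
by move/addIr/z_inj/addIr.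
Qed.

(** With [h] the direction of the current twist site, [x] is the coefficient of
    the arcs on which a new crossing makes a curl, and [y] that of the arcs
    which a new crossing turns into a single crossing: for [h = true] these are
    the vertical and the horizontal arcs, in this order. *)
Definition expands (h : bool) (T : diagram) (x y w : laurent) : Prop :=
  forall u v, context 2 2 u v ->
  Lambda (u ++ T ++ v) =
    (if h then x else y) * Lambda (u ++ v)
    + (if h then y else x) * Lambda (u ++ [:: (Cap, 0%N); (Cup, 0%N)] ++ v)
    + w * Lambda (u ++ [:: X true 0] ++ v).

Lemma expandsC h T x y w : expands h T x y w -> expands (~~ h) T y x w.
Proof. by case: h. Qed.

Definition attach (h : bool) : diagram -> diagram :=
  if h then hsum_crossing else vsum_crossing.

Lemma expands_attach h T x y w : expands h T x y w ->
  expands h (attach h T)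
    (curl_factor h * (x + z * w)) (- w) (y + z * w).
Proof.
case: h => T_eq u v uv /=.
- have uv1 : context 2 2 (u ++ [:: (Cup, 1%N)]) ([:: X true 2; (Cap, 1%N)] ++ v).
    (* the tangle meets two strands; the minimum has added two on their right *)
    exact/(@context_shift 2)/(context_extend uv).
  rewrite /hsum_crossing -cat1s -!catA catA (T_eq _ _ uv1) -!catA.
  have /= -> := left_curl uv; have /= -> := hsum_arcs true uv.
  by have /= -> := hsum_cross_skein_right uv; ring.
- have uv1 : context 2 2 (u ++ [:: X true 0]) ([::] ++ v).
    exact: (context_extend (w := [:: X true 0]) (w' := [::]) uv).
  have uv0 : context 2 0 u ([:: (Cup, 0%N)] ++ v).
    by rewrite -[u]cats0; apply: context_extend uv _ _.
  have := T_eq _ _ uv1; rewrite -!catA /= => ->.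
  have /= -> := cross_cap true uv0.
  by have /= -> := cross_cross uv; ring.
Qed.

End Skein.

(** * Growing the tangle *)

Section Growing.
Variable Lambda : diagram -> laurent.
Hypothesis hLambda : is_kauffman_invariant Lambda.

Definition grown (h : bool) (j n : nat) (T : diagram) : Prop :=
  crossings T = n.+2 /\
  exists x y w, expands Lambda h T x y w /\ leading h j n x y w.

Lemma crossings_numerator T : crossings (numerator T) = crossings T.
Proof. by rewrite /crossings /numerator -cat1s !count_cat addn0. Qed.

Lemma crossings_attach h T : crossings (attach h T) = (crossings T).+1.
Proof.
by case: h; rewrite /crossings //= count_cat /= addn0 addn1.
Qed.

(** A single crossing is not yet of the shape [leading], whence two crossings;
    this is where the first site must have at least two. *)
Lemma grown_start h :
  grown h 0 0
    (iter 2 (attach h) (if h then [:: (Cap, 0%N); (Cup, 0%N)] else [::])).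
Proof.
set T0 := (if h then _ else _).
have T0_eq : expands Lambda h T0 0 1 0.
  by move=> u v uv; rewrite /T0; case: (h); rewrite /= !mul0r !mul1r ?(addr0, add0r).
split; first by rewrite !crossings_attach /T0; case: (h).
have T2_eq := expands_attach hLambda (expands_attach hLambda T0_eq).
do 3!eexists; split; first exact: T2_eq.
have zdeg_le0 d : zdeg_le d 0 by move=> i j _; rewrite mcoeff0.
suff init x y w : x = curl_factor h * z -> y = -1 -> w = z -> leading h 0 0 x y w.
  by apply: init; ring.
move=> -> -> ->; split; first by rewrite expr1 subrr.
- by rewrite expr0 addNr.
- by rewrite expr1 subrr /transitions !mul0r addr0 mul0r subr0.
Qed.

Lemma grown_same h j n T :
  grown h j n T -> grown h j n.+1 (attach h T).
Proof.
case=> cT [x [y [w [T_eq xyw]]]]; split; first by rewrite crossings_attach cT.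
have T'_eq := expands_attach hLambda T_eq.
by do 3!eexists; split; [exact: T'_eq | exact: leading_same xyw].
Qed.

Lemma grown_switch h j n T :
  grown h j n T -> grown (~~ h) j.+1 n.+1 (attach (~~ h) T).
Proof.
case=> cT [x [y [w [T_eq xyw]]]]; split; first by rewrite crossings_attach cT.
have T'_eq := expands_attach hLambda (expandsC T_eq).
by do 3!eexists; split; [exact: T'_eq | exact: leading_switch xyw].
Qed.

Lemma grown_site h j n b T : (0 < b)%N ->
  grown h j n T -> grown (~~ h) j.+1 (n + b) (iter b (attach (~~ h)) T).
Proof.
case: b => // b _ /grown_switch T_gr; rewrite addnS.
by elim: b => [|b IHb]; rewrite ?addn0 // addnS; apply: grown_same.
Qed.

Lemma grown_sites h j n T s : all (leq 1) s -> grown h j n T ->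
  grown (h (+) odd (size s)) (j + size s) (n + sumn s)
        (add_twist_sites (~~ h) T s).
Proof.
elim: s h j n T => [|b s IHs] h j n T /=; first by rewrite addbF !addn0.
case/andP=> b_gt0 s_gt0 /(grown_site b_gt0)/(IHs _ _ _ _ s_gt0).
by rewrite addNb addbN addSnnS addnA.
Qed.

Lemma add_twist_sites_rcons h T s r :
  add_twist_sites h T (rcons s r)
  = iter r (attach (h (+) odd (size s))) (add_twist_sites h T s).
Proof.
elim: s h T => [|b s IHs] h T /=; first by rewrite addbF.
by rewrite IHs addNb addbN.
Qed.

(** * Closing the tangle *)

Lemma circle_solve (R : comPzRingType) (x xi a a' d : R) :
  xi * x = 1 -> a' * 1 + a * 1 = x * (1 + d) -> d = xi * (a + a') - 1.
Proof.
move=> xi_x; rewrite !mulr1 addrC => ->.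
by rewrite mulrA xi_x mul1r addrAC subrr add0r.
Qed.

(** The value of two circles, from the skein relation for one crossing closed up
    to the two opposite curls. *)
Lemma numerator_circles :
  Lambda (numerator [:: (Cap, 0%N); (Cup, 0%N)])
  = mon 0 (-1) * (curl_factor true + curl_factor false) - 1.
Proof.
have uv : context 2 2 [:: (Cup, 0%N)] [:: (Cap, 0%N)] by exists 0%N.
have uv0 : context 2 0 [:: (Cup, 0%N)] [::] by exists 0%N.
have := skein_in hLambda uv (l := [::]) (r := [::]) (i := 0) erefl.
have /= -> := cross_cap hLambda true uv0.
have /= -> := cross_cap hLambda false uv0.
rewrite (kauffman_circle hLambda); apply: circle_solve.
by rewrite monM.
Qed.

(** The terms of degrees [n + 1] and [n] in z of the invariant of a closed tangle
    with [n + 2] crossings, whose last site is horizontal, has at least two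
    crossings and comes after [j] changes of direction. *)
Definition main_part (j n : nat) : laurent :=
  ((curl_factor true + curl_factor false) * (z + transitions true j)
   + curl_factor true ^+ 2 + 1) * z ^+ n.

(** Here [xz], [xi] and [Z] stand for z, its inverse and a power of z. The left-hand
    side is the invariant minus its main part, the right-hand side a combination
    of the error terms in [leading] and of terms of low degree. *)
Lemma numerator_expansion (R : comPzRingType) (a a' xz xi x y w t Z : R) :
  a * (x + xz * w) * 1 + - w * (xi * (a + a') - 1) + (y + xz * w) * (a' * 1)
    - ((a + a') * (xz + t) + a ^+ 2 + 1) * (xz * Z)
  = a * (x - a * (xz * Z)) + (a + a') * (xz * (w - xz * Z - t * Z))
    + a' * y + (w - xz * Z) - w * xi * (a + a').
Proof. ring. Qed.

(** The second coefficient of [x] is needed here. It is determined by the shape of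
    the coefficients before the last crossing, provided that this crossing
    continues a site: hence the tangle [T] without it, and the requirement of at
    least two crossings in the last site. *)
Lemma numerator_leading j n T : grown true j n T ->
  zdeg_le n (Lambda (numerator (hsum_crossing T)) - main_part j n.+1).
Proof.
case=> _ [x [y [w [T_eq xyw]]]].
have uv : context 2 2 [:: (Cup, 0%N)] [:: (Cap, 0%N)] by exists 0%N.
have uv0 : context 2 0 [:: (Cup, 0%N)] [::] by exists 0%N.
have /= := expands_attach hLambda T_eq uv.
have /= -> := cross_cap hLambda true uv0.
have /= -> := numerator_circles.
rewrite (kauffman_circle hLambda) => ->.
set t := transitions true j; set a := curl_factor true; set a' := curl_factor false.
set zi := mon 0 (-1).
rewrite /main_part (exprS _ n) numerator_expansion -(exprS _ n) -/t -/a -/a'.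
have le_a b : zdeg_le 0 (curl_factor b) by apply: zdeg_le_curl_factor.
have le_aa : zdeg_le 0 (a + a') by apply: zdeg_leD; apply: le_a.
have le_w := leading_cross_le xyw.
apply: zdeg_leD; last first.
  apply: zdeg_leN; apply: (@zdeg_leM n 0) le_aa _; last by lia.
  apply: (zdeg_leM (d := n.+1) (d' := -1)); [|exact: zdeg_le_mon|lia].
  rewrite -[w](subrK (z ^+ n.+1)); apply: zdeg_leD; last exact: zdeg_le_z.
  by apply: zdeg_leW le_w; lia.
apply: zdeg_leD; last exact: le_w.
apply: zdeg_leD; last first.
  by apply: (zdeg_leM (le_a false) (leading_flat_le xyw)); lia.
apply: zdeg_leD.
  by apply: (zdeg_leM (le_a true) (leading_turn xyw)); lia.
by apply: (zdeg_leM le_aa (leading_z_cross xyw)); lia.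
Qed.

End Growing.

(** * Truncation *)

(** The exponents of z kept by [truncated] are [c - 1] and [c - 2]. *)
Lemma truncated_main L D (c n : nat) (f : laurent) : crossings D = c ->
  c = n.+3 -> zdeg_le n (L D - f) -> truncated L D = truncated (fun=> f) D.
Proof.
move=> cD c_n Lf; rewrite /truncated cD; apply: eq_big_seq => m.
move=> m_in; congr (<< _ *g _ >>); apply/eqP; rewrite -subr_eq0 -mcoeffB.
move: m m_in => [i j] m_in; apply/eqP/Lf.
move: m_in; rewrite !inE !xpair_eqE c_n.
by do ![case/orP]; case/andP=> _ /eqP ->; lia.
Qed.

Lemma natMmon n i j : n%:R * mon i j = << n%:Z *g (i, j) >>.
Proof.
elim: n => [|n IHn]; first by rewrite mul0r monalgU0.
by rewrite mulrS mulrDl mul1r IHn -monalgUD.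
Qed.

(** Keeping the terms in a list of monomials does nothing to a combination of
    these monomials. *)
Lemma restrict_support (s : seq (int * int)) (e : int * int -> int) :
  let f : laurent := \sum_(m <- s) << e m *g m >> in
  uniq s -> \sum_(m <- s) << f@_m *g m >> = f.
Proof.
move=> f s_uniq; rewrite {2}/f; apply: eq_big_seq => m m_s.
congr (<< _ *g _ >>); rewrite /f raddf_sum /= (bigD1_seq m) //= mcoeffUU.
rewrite big1_seq ?addr0 // => n /andP[n_m _].
by rewrite mcoeffU (negPf n_m).
Qed.

Lemma sum5 (R : comPzRingType) (x1 x2 x3 x4 x5 : R) :
  x3 + x2 + x1 + x5 + x4 = x1 + (x2 + (x3 + (x4 + (x5 + 0)))).
Proof. ring. Qed.

Lemma truncated_id L D (c2 c0 cm2 : nat) :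
  let c := (crossings D)%:Z in
  L D = c2%:R * mon 2 (c - 2) + c0%:R * mon 0 (c - 2) + cm2%:R * mon (-2) (c - 2)
        + mon 1 (c - 1) + mon (-1) (c - 1) ->
  truncated L D = L D.
Proof.
move=> c LD.
(* the exponents of a tell the five monomials apart *)
pose e (m : int * int) : int :=
  if m.1 == 2 then c2 else if m.1 == 0 then c0 else if m.1 == -2 then cm2 else 1.
rewrite /truncated.
have -> : L D = \sum_(m <- [:: (-2, c - 2); (0, c - 2); (2, c - 2);
                              (-1, c - 1); (1, c - 1)]) << e m *g m >>.
  by rewrite LD !natMmon !big_cons big_nil; apply: sum5.
exact: restrict_support.
Qed.

Lemma main_part_expand (R : comPzRingType) (a a' xz Z s s0 s' t t' : R)
    (u f c2 c0 c2' : nat) :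
  a * a' = 1 -> a ^+ 2 * Z = s -> Z = s0 -> a' ^+ 2 * Z = s' ->
  a * (xz * Z) = t -> a' * (xz * Z) = t' ->
  c2 = f.+1 -> c0 = (u + f).+1 -> c2' = u ->
  ((a + a') * (xz + (u%:R * a' + f%:R * a)) + a ^+ 2 + 1) * Z
  = c2%:R * s + c0%:R * s0 + c2'%:R * s' + t + t'.
Proof.
move=> aa' <- <- <- <- <- -> -> ->; rewrite -!natr1 natrD.
have -> : (u%:R + f%:R + 1) * Z = (u%:R + f%:R) * (a * a') * Z + Z.
  by rewrite aa'; ring.
ring.
Qed.

(** Since [a * a^-1 = 1], every change of direction contributes one to the
    constant coefficient, and one to the coefficient of [a ^+ 2] or of
    [a ^- 2]. *)
Lemma main_part_mon k n :
  main_part k.+1 n = (uphalf (k + 2))%:R * mon 2 n%:Z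
    + (k + 2)%:R * mon 0 n%:Z
    + ((k + 2)./2)%:R * mon (-2) n%:Z
    + mon 1 (n%:Z + 1)
    + mon (-1) (n%:Z + 1).
Proof.
have squareE b : curl_factor b ^+ 2 * z ^+ n = mon (if b then 2 else -2) n%:Z.
  by rewrite mon_z_expr expr2 !monM; case: b.
have zE b : curl_factor b * (z * z ^+ n) = mon (if b then 1 else -1) (n%:Z + 1).
  by rewrite mon_z_expr !monM addr0 add0r addrC.
have inverseE : curl_factor true * curl_factor false = 1 by rewrite monM.
rewrite /main_part /transitions.
apply: (main_part_expand inverseE (squareE true) (mon_z_expr n) (squareE false)
          (zE true) (zE false)); rewrite addn2 //.
by rewrite uphalf_half -addnA addnn odd_double_half.
Qed.

Theorem theorem4p1 (Lambda : diagram -> laurent)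
  (hLambda : is_kauffman_invariant Lambda)
  (k p r : nat) (q : k.-tuple nat)
  (hk : (1 <= k)%N) (hp : (2 <= p)%N) (hr : (2 <= r)%N)
  (hq : forall i : 'I_k, (1 <= tnth q i)%N) :
  let T := rational_tangle (p :: rcons q r) in
  let c := (p + \sum_(i < k) tnth q i + r)%N in
  truncated Lambda (numerator T) =
    (uphalf (k + 2))%:R * mon 2 (c%:Z - 2)
    + (k + 2)%:R * mon 0 (c%:Z - 2)
    + ((k + 2)./2)%:R * mon (-2) (c%:Z - 2)
    + mon 1 (c%:Z - 1)
    + mon (-1) (c%:Z - 1).
Proof.
move=> T c; set h := odd k.
case: p hp @c @T => [|[|p]] // _; case: r hr => [|[|r]] // _ c T.
have sum_q : sumn q = \sum_(i < k) tnth q i by rewrite sumnE big_tuple.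
have c_eq : c = (p + sumn q + r.+1).+3 by rewrite /c -sum_q !addSn !addnS.
have q_gt0 : all (leq 1) q by apply/all_tnthP.
have T1_gr : grown Lambda h 0 p
    (iter p.+2 (attach h) (if h then [:: (Cap, 0%N); (Cup, 0%N)] else [::])).
  elim: p {c c_eq T} => [|p IHp]; first exact: grown_start.
  exact: grown_same hLambda _ _ _ _ IHp.
have := grown_sites hLambda q_gt0 T1_gr; set T2 := add_twist_sites _ _ _.
rewrite size_tuple addbb => /(grown_site hLambda (ltn0Sn r)) T3_gr.
have eqT : T = hsum_crossing (iter r.+1 (attach true) T2).
  rewrite /T /rational_tangle /= size_rcons size_tuple /= !negbK -/h.
  by rewrite add_twist_sites_rcons size_tuple addNb addbb.
have := numerator_leading hLambda T3_gr; rewrite -eqT => /truncated_main trunc.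
have cD : crossings (numerator T) = c.
  case: T3_gr => cT3 _.
  by rewrite crossings_numerator eqT (crossings_attach true) cT3.
rewrite (trunc c) //.
have eq_c2 : c%:Z - 2 = (p + sumn q + r.+1).+1%:Z by rewrite c_eq; lia.
have eq_c1 : c%:Z - 1 = (p + sumn q + r.+1).+1%:Z + 1 by rewrite c_eq; lia.
rewrite eq_c2 eq_c1 -main_part_mon.
apply: (truncated_id (c2 := uphalf (k + 2)) (c0 := k + 2) (cm2 := (k + 2)./2)).
by rewrite cD eq_c2 eq_c1; apply: main_part_mon.
Qed.
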